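(* Let $\mathcal{A}$ be an arbitrary C*-algebra, let $X$ be a Hilbert $\mathcal{A}$-module, and let $T, S \in \mathcal{L}(X)$ be such that $T$ and $TS$ are normal and $T$ has polar decomposition. Then $ST$ is normal if and only if $S$ commutes with $|T|$.
   Context: A (right) Hilbert $\mathcal{A}$-module is a right $\mathcal{A}$-module $X$ with an $\mathcal{A}$-valued inner product $\langle\cdot,\cdot\rangle$, $\mathcal{A}$-linear in the second variable, with $\langle x,y\rangle=\langle y,x\rangle^*$ and $\langle x,x\rangle\ge 0$ with equality only when $x=0$, that is complete for the norm $\|x\|=\|\langle x,x\rangle\|^{1/2}$. $\mathcal{L}(X)$ is the C*-algebra of all adjointable operators on $X$, i.e. $\mathcal{A}$-linear maps $T:X\to X$ for which there is $T^*:X\to X$ with $\langle Tx,y\rangle=\langle x,T^*y\rangle$ for all $x,y\in X$. $T\in\mathcal{L}(X)$ is normal if $T^*T=TT^*$; $\mathcal{V}\in\mathcal{L}(X)$ is a partial isometry if $\mathcal{V}\mathcal{V}^*\mathcal{V}=\mathcal{V}$. $|T|=(T^*T)^{1/2}$. $Ker$ and $Ran$ denote kernel and range. ''$T$ has polar decomposition'' means that there is a partial isometry $\mathcal{V}\in\mathcal{L}(X)$ with $T=\mathcal{V}|T|$, $Ker(\mathcal{V})=Ker(T)$, $Ker(\mathcal{V}^* )=Ker(T^* )$, $Ran(\mathcal{V})=\overline{Ran(T)}$ and $Ran(\mathcal{V}^* )=\overline{Ran(T^* )}$. Such a $\mathcal{V}$ exists (and is then unique) if and only if $X=Ker(|T|)\oplus\overline{Ran(|T|)}$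 and $X=Ker(T^* )\oplus\overline{Ran(T)}$. *)

(* Defs.v *)
From HB Require Import structures.
From mathcomp Require Import all_boot all_order all_algebra.
From mathcomp Require Import all_classical all_reals all_analysis.
From mathcomp.real_closed Require Export complex.

Set Implicit Arguments.
Unset Strict Implicit.
Unset Printing Implicit Defensive.

Import Order.TTheory GRing.Theory Num.Theory.
Import numFieldNormedType.Exports.

Local Open Scope classical_set_scope.
Local Open Scope ring_scope.

Reserved Notation "a ** b" (at level 40, left associativity).

(* Associative star-algebras over K, NOT assumed to have a unit (MathComp's
   algType is unital).  The intended field of scalars is K = R[i] with
   R : realType; the definitions only need conjugation and order on K. *)
HB.mixin Record Lmodule_isStarAlgebra (K : numClosedFieldType) A
    of GRing.Lmodule K A := {
  amul : A -> A -> A;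
  star : A -> A;
  amulA : forall a b c, amul a (amul b c) = amul (amul a b) c;
  amulDl : forall a b c, amul (a + b) c = amul a c + amul b c;
  amulDr : forall a b c, amul a (b + c) = amul a b + amul a c;
  amulZl : forall (k : K) a b, amul (k *: a) b = k *: amul a b;
  amulZr : forall (k : K) a b, amul a (k *: b) = k *: amul a b;
  starK : forall a, star (star a) = a;
  starD : forall a b, star (a + b) = star a + star b;
  starZ : forall (k : K) a, star (k *: a) = k^* *: star a;
  starM : forall a b, star (amul a b) = amul (star b) (star a)
}.

#[short(type="starAlgType")]
HB.structure Definition StarAlgebra (K : numClosedFieldType) :=
  {A of GRing.Lmodule K A & Lmodule_isStarAlgebra K A}.

Notation "a ** b" := (amul a b) : ring_scope.

HB.mixin Record StarAlgebra_isCStarAlgebra (K : numClosedFieldType) A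
    of StarAlgebra K A & CompleteNormedModule K A := {
  ler_norm_amul : forall a b : A, `|a ** b| <= `|a| * `|b|;
  norm_star_amul : forall a : A, `|star a ** a| = `|a| ^+ 2
}.

#[short(type="cstarAlgType")]
HB.structure Definition CStarAlgebra (K : numClosedFieldType) :=
  {A of StarAlgebra K A & CompleteNormedModule K A
      & StarAlgebra_isCStarAlgebra K A}.

Section StarAlgebraTheory.
Context {K : numClosedFieldType} {A : starAlgType K}.
Implicit Types a b : A.

(* The product of the unitization A + K.1, the pair (a, k) standing for
   a + k.1. *)
Definition unitization_mul (x y : A * K) : A * K :=
  (x.1 ** y.1 + x.2 *: y.1 + y.2 *: x.1, x.2 * y.2).

(* The spectrum is always taken in the unitization.  When A already has a unit
   this may only add the value 0, which is irrelevant to positivity. *)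
Definition spectrum a : set K :=
  [set k | ~ exists y : A * K, unitization_mul (a, - k) y = (0, 1)
                            /\ unitization_mul y (a, - k) = (0, 1)].

(* In a numClosedFieldType, 0 <= k means that k is real and nonnegative. *)
Definition positive a := star a = a /\ forall k, spectrum a k -> 0 <= k.

(* The positive square root of a; by convention 0 if there is none. *)
Definition psqrt a : A := xget 0 [set b | positive b /\ b ** b = a].

Definition modulus a : A := psqrt (star a ** a).

Definition normal a := star a ** a = a ** star a.

Definition partial_isometry a := a ** star a ** a = a.

Definition commutes a b := a ** b = b ** a.

End StarAlgebraTheory.

(* The norm and the topology are those of the underlying complete normed
   module; norm_inner states that this norm is the one coming from the inner
   product. *)
HB.mixin Record isHilbertModule (K : numClosedFieldType) (A : cstarAlgType K) X
    of CompleteNormedModule K X := {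
  ract : X -> A -> X;
  inner : X -> X -> A;
  ractDl : forall x y a, ract (x + y) a = ract x a + ract y a;
  ractDr : forall x a b, ract x (a + b) = ract x a + ract x b;
  ractM : forall x a b, ract x (a ** b) = ract (ract x a) b;
  ractZl : forall (k : K) x a, ract (k *: x) a = k *: ract x a;
  ractZr : forall (k : K) x a, ract x (k *: a) = k *: ract x a;
  innerDr : forall x y z, inner x (y + z) = inner x y + inner x z;
  innerZr : forall (k : K) x y, inner x (k *: y) = k *: inner x y;
  inner_ract : forall x y a, inner x (ract y a) = inner x y ** a;
  inner_star : forall x y, star (inner y x) = inner x y;
  inner_ge0 : forall x, positive (inner x x);
  inner_eq0 : forall x, inner x x = 0 -> x = 0;
  norm_inner : forall x, `|x| = sqrtC `|inner x x|
}.

#[short(type="hilbertModType")]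
HB.structure Definition HilbertModule (K : numClosedFieldType)
    (A : cstarAlgType K) :=
  {X of CompleteNormedModule K X & isHilbertModule K A X}.

Section AdjointableOperators.
Context {K : numClosedFieldType} {A : cstarAlgType K} (X : hilbertModType A).
Implicit Types (x y : X).

Definition module_linear (T : X -> X) :=
  linear T /\ forall x (a : A), T (ract x a) = ract (T x) a.

Definition is_adjoint (T Ts : X -> X) := forall x y, inner (T x) y = inner x (Ts y) :> A.

Definition adjointable : {pred X -> X} :=
  mem [set T | module_linear T /\ exists Ts, is_adjoint T Ts].

Record adjop := AdjOp { adjfun :> X -> X; _ : adjfun \in adjointable }.

HB.instance Definition _ := [isSub for adjfun].
HB.instance Definition _ := [Choice of adjop by <:].

Lemma adjopP (S : adjop) : module_linear S /\ exists Ts, is_adjoint S Ts.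
Proof. by case: S => T /= /set_mem. Qed.

Lemma adjop_eq (S1 S2 : adjop) : S1 =1 S2 -> S1 = S2.
Proof. by move=> e; apply: val_inj; apply/funext. Qed.

Lemma innerDl x y z : inner (x + y) z = inner x z + inner y z :> A.
Proof. by rewrite -inner_star innerDr starD !inner_star. Qed.

Lemma innerZl k x y : inner (k *: x) y = k^* *: inner x y :> A.
Proof. by rewrite -inner_star innerZr starZ inner_star. Qed.

Lemma ract0l (a : A) : ract 0 a = 0 :> X.
Proof. by have := ractZl 0 (0 : X) a; rewrite !scale0r. Qed.

Lemma inner0l x : inner 0 x = 0 :> A.
Proof. by have := innerZl 0 (0 : X) x; rewrite rmorph0 !scale0r. Qed.

Lemma inner0r x : inner x 0 = 0 :> A.
Proof. by have := innerZr 0 x (0 : X); rewrite !scale0r. Qed.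

Lemma inner_ext x y : (forall z, inner z x = inner z y :> A) -> x = y.
Proof.
move=> e; apply/eqP; rewrite -subr_eq0; apply/eqP; apply: (@inner_eq0 _ A).
have -> : inner (x - y) (x - y) = inner (x - y) x - inner (x - y) y :> A.
  by rewrite -[in X in _ (x - y) X](scaleN1r y) innerDr innerZr scaleN1r.
by rewrite e subrr.
Qed.

Lemma adjointable_submod : submod_closed adjointable.
Proof.
split.
  apply/mem_set; split; first split.
  - by move=> k u v /=; rewrite scaler0 addr0.
  - by move=> x a; change ((0 : X) = ract 0 a); rewrite ract0l.
  - exists 0 => x y; change (inner (0 : X) y = inner x 0 :> A).
    by rewrite inner0l inner0r.
move=> k f g /set_mem[[fl fa] [fs fP]] /set_mem[[gl ga] [gs gP]].
apply/mem_set; split; first split.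
- move=> l u v; change (k *: f (l *: u + v) + g (l *: u + v) =
    l *: (k *: f u + g u) + (k *: f v + g v)).
  rewrite fl gl !scalerDr !scalerA (mulrC k l) -!addrA; congr (_ + _).
  by rewrite addrCA.
- move=> x a; change (k *: f (ract x a) + g (ract x a) =
    ract (k *: f x + g x) a).
  by rewrite fa ga ractDl ractZl.
exists (fun y => k^* *: fs y + gs y) => x y.
change (inner (k *: f x + g x) y = inner x (k^* *: fs y + gs y) :> A).
by rewrite innerDl innerZl innerDr innerZr fP gP.
Qed.

HB.instance Definition _ :=
  GRing.isSubmodClosed.Build _ _ adjointable adjointable_submod.

HB.instance Definition _ := [SubChoice_isSubLmodule of adjop by <:].

Lemma adjopD (S T : adjop) x : (S + T) x = S x + T x.
Proof. by []. Qed.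

Lemma adjopZ k (S : adjop) x : (k *: S) x = k *: S x.
Proof. by []. Qed.

Lemma adjoint_adjointable (S : adjop) Ts :
  is_adjoint S Ts -> Ts \in adjointable.
Proof.
move=> ST; apply/mem_set; split; first split.
- by move=> k u v; apply: inner_ext => z; rewrite innerDr innerZr -!ST innerDr innerZr.
- by move=> u a; apply: inner_ext => z; rewrite inner_ract -!ST inner_ract.
by exists S => x y; rewrite -inner_star -ST inner_star.
Qed.

(* Since inner is definite, the adjoint is unique: see adjoint_unique. *)
Definition adjoint (S : adjop) : adjop :=
  AdjOp (adjoint_adjointable (projT2 (cid (adjopP S).2))).

Lemma adjointP (S : adjop) : is_adjoint S (adjoint S).
Proof. exact: (projT2 (cid (adjopP S).2)). Qed.

Lemma adjoint_unique (S T : adjop) : is_adjoint S T -> T = adjoint S.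
Proof.
move=> ST; apply: adjop_eq => y; apply: inner_ext => x.
by rewrite -ST -adjointP.
Qed.

Lemma adjcomp_adjointable (S T : adjop) : (S \o T)%FUN \in adjointable.
Proof.
have [[Sl Sa] _] := adjopP S; have [[Tl Ta] _] := adjopP T.
apply/mem_set; split; first split.
- by move=> k u v /=; rewrite Tl Sl.
- by move=> u a /=; rewrite Ta Sa.
by exists (adjoint T \o adjoint S)%FUN => x y /=; rewrite !adjointP.
Qed.

Definition adjcomp (S T : adjop) : adjop := AdjOp (adjcomp_adjointable S T).

Implicit Types S T U : adjop.

Lemma adjcompA S T U : adjcomp S (adjcomp T U) = adjcomp (adjcomp S T) U.
Proof. by apply: adjop_eq. Qed.

Lemma adjcompDl S T U : adjcomp (S + T) U = adjcomp S U + adjcomp T U.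
Proof. by apply: adjop_eq. Qed.

Lemma adjcompDr S T U : adjcomp S (T + U) = adjcomp S T + adjcomp S U.
Proof.
apply: adjop_eq => x; have [[Sl _] _] := adjopP S.
by have := Sl 1 (T x) (U x); rewrite !scale1r.
Qed.

Lemma adjcompZl k S T : adjcomp (k *: S) T = k *: adjcomp S T.
Proof. by apply: adjop_eq. Qed.

Lemma adjcompZr k S T : adjcomp S (k *: T) = k *: adjcomp S T.
Proof.
apply: adjop_eq => x; change (S (k *: T x) = k *: S (T x)).
have [[Sl _] _] := adjopP S.
have S0 : S 0 = 0.
  by apply: (addrI (S 0)); have := Sl 1 0 0; rewrite !scale1r !addr0 => <-.
by have := Sl k (T x) 0; rewrite S0 !addr0.
Qed.

Lemma adjointK S : adjoint (adjoint S) = S.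
Proof.
by apply/esym/adjoint_unique => x y; rewrite -inner_star -adjointP inner_star.
Qed.

Lemma adjointD S T : adjoint (S + T) = adjoint S + adjoint T.
Proof.
apply/esym/adjoint_unique => x y.
by rewrite !adjopD innerDl innerDr !adjointP.
Qed.

Lemma adjointZ k S : adjoint (k *: S) = k^* *: adjoint S.
Proof.
apply/esym/adjoint_unique => x y.
by rewrite !adjopZ innerZl innerZr !adjointP.
Qed.

Lemma adjointM S T : adjoint (adjcomp S T) = adjcomp (adjoint T) (adjoint S).
Proof. by apply/esym/adjoint_unique => x y /=; rewrite !adjointP. Qed.

(* L(X) is a star-algebra for composition and adjunction: S ** T is S \o T and
   star T is T^*. *)
HB.instance Definition _ := Lmodule_isStarAlgebra.Build K adjop
  adjcompA adjcompDl adjcompDr adjcompZl adjcompZr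
  adjointK adjointD adjointZ adjointM.

Definition Ker (T : adjop) : set X := [set x | T x = 0].

Definition Ran (T : adjop) : set X := range T.

Definition has_polar_decomposition (T : adjop) :=
  exists V : adjop,
    [/\ partial_isometry V,
        T = V ** modulus T,
        Ker V = Ker T /\ Ker (star V) = Ker (star T),
        Ran V = closure (Ran T) &
        Ran (star V) = closure (Ran (star T))].

End AdjointableOperators.

(* Main.v *)
Require Import Defs.
From HB Require Import structures.
From mathcomp Require Import all_boot all_order all_algebra.
From mathcomp Require Import all_classical all_reals all_analysis.
From mathcomp Require Import separable cyclic cyclotomic ring zify lra.

Set Implicit Arguments.
Unset Strict Implicit.
Unset Printing Implicit Defensive.

Import Order.TTheory GRing.Theory Num.Theory.
Import numFieldNormedType.Exports.

Local Open Scope classical_set_scope.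
Local Open Scope ring_scope.
Local Open Scope complex_scope.

(* If [N = TS] and [M = ST] are normal, then [N T = T M] gives [N^* T = T M^*] by
   Fuglede-Putnam, i.e. [S] commutes with [T^* T = |T|^2], hence with [|T|].
   Conversely, when [T] is normal the partial isometry [V] of its polar
   decomposition satisfies [V^* V = V V^*] and commutes with [|T|], so that
   [ST = V^* (TS) V] is normal because [TS] is.

   No functional calculus is used.  An adjointable operator is bounded, by a
   gliding hump argument, and everything rests on estimates of [|G x|], the key
   remark being that [|G x| = |G^* x|] for normal [G].  Fuglede-Putnam is
   Rosenblum's proof by Liouville's theorem, where [exp (z B)] is replaced by
   [(1 + z B / n) ^ n] and Liouville's theorem by Cauchy's estimate for
   polynomials.  The same argument shows that commuting with [P^2] implies
   commuting with [P >= 0], once [|(P + s) x| >= s |x|] for [s >= 0] is known;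
   the latter follows from [P] being a limit of squares of self-adjoint
   operators, which is true of [P + t] for large [t] and propagates down to
   [t = 0] because [P + t] is invertible for all [t > 0]. *)

(** * Hilbert modules: polarization and boundedness of adjointable operators *)

Section RealNorm.
Context {R : realType}.

(** Norms over [R[i]] take values in [R[i]]; this is the same number seen in the totally ordered
    field [R]. *)
Definition rnorm (V : normedZmodType R[i]) (x : V) : R := complex.Re `|x|.

Section NormedZmod.
Context {V : normedZmodType R[i]}.
Implicit Types x y : V.

Lemma rnormE x : (rnorm x)%:C = `|x|.
Proof.
have := normr_ge0 x; rewrite /rnorm; move: `|x| => [a b].
by rewrite lecE /= => /andP[/eqP-> _].
Qed.

Lemma rnorm_eqP (W : normedZmodType R[i]) x (y : W) :
  `|x| = `|y| -> rnorm x = rnorm y.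
Proof. by rewrite /rnorm => ->. Qed.

Lemma rnorm_ge0 x : 0 <= rnorm x.
Proof. by rewrite -ler0c rnormE. Qed.

Lemma rnorm0 : rnorm (0 : V) = 0.
Proof. by rewrite /rnorm normr0. Qed.

Lemma rnorm_eq0 x : (rnorm x == 0) = (x == 0).
Proof. by rewrite -(normr_eq0 x) -rnormE -(inj_eq (@complexI R)). Qed.

Lemma rnormN x : rnorm (- x) = rnorm x.
Proof. by rewrite /rnorm normrN. Qed.

Lemma rnormD x y : rnorm (x + y) <= rnorm x + rnorm y.
Proof. by rewrite -lecR rmorphD /= !rnormE ler_normD. Qed.

Lemma rnormB x y : rnorm (x - y) <= rnorm x + rnorm y.
Proof. by rewrite -(rnormN y) rnormD. Qed.

Lemma rnorm_sum (I : Type) (s : seq I) (F : I -> V) :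
  rnorm (\sum_(i <- s) F i) <= \sum_(i <- s) rnorm (F i).
Proof.
elim/big_rec2: _ => [|i r x _ le]; first by rewrite rnorm0.
by rewrite (le_trans (rnormD _ _))// lerD2l.
Qed.

End NormedZmod.

Lemma rnormM (k l : R[i]) : rnorm (k * l) = rnorm k * rnorm l.
Proof. by apply: complexI; rewrite rmorphM /= !rnormE normrM. Qed.

Lemma rnorm_conj (k : R[i]) : rnorm k^* = rnorm k.
Proof. by apply: complexI; rewrite !rnormE norm_conjC. Qed.

Lemma rnormX (k : R[i]) n : rnorm (k ^+ n) = rnorm k ^+ n.
Proof. by apply: complexI; rewrite rmorphXn /= !rnormE normrX. Qed.

Lemma rnorm_real (r : R) : rnorm r%:C = `|r|.
Proof. by apply: complexI; rewrite rnormE normc_def /= expr0n addr0 sqrtr_sqr. Qed.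

Lemma rnorm1 : rnorm (1 : R[i]) = 1.
Proof. by rewrite -[1]/(1%:C) rnorm_real normr1. Qed.

Lemma rnormi : rnorm ('i : R[i]) = 1.
Proof. by apply: complexI; rewrite rnormE normCi. Qed.

Lemma rnormZ (V : normedModType R[i]) (k : R[i]) (x : V) :
  rnorm (k *: x) = rnorm k * rnorm x.
Proof. by apply: complexI; rewrite rmorphM /= !rnormE normrZ. Qed.

(** Telescoping against a geometric series gives convergence together with an explicit tail bound,
    which the gliding hump of [adjop_bounded] relies on. *)
Lemma rnorm_cvg (V : completeNormedModType R[i]) (u : nat -> V) (c q : R) :
  0 <= q < 1 -> (forall n, rnorm (u n.+1 - u n) <= c * q ^+ n) ->
  exists l, forall n, rnorm (l - u n) <= c * q ^+ n / (1 - q).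
Proof.
move=> /andP[q0 q1] cq.
have q1' : 0 < 1 - q by rewrite subr_gt0.
have c0 : 0 <= c.
  by have := cq 0%N; rewrite expr0 mulr1; apply: le_trans; rewrite rnorm_ge0.
have un n k : rnorm (u (n + k)%N - u n) <= c * q ^+ n * (1 - q ^+ k) / (1 - q).
  elim: k => [|k IH]; first by rewrite addn0 subrr rnorm0 expr0 subrr mulr0 mul0r.
  have -> : u (n + k.+1)%N - u n = (u (n + k).+1 - u (n + k)%N) + (u (n + k)%N - u n).
    by rewrite addnS addrA subrK.
  apply: (le_trans (rnormD _ _)); apply: (le_trans (lerD (cq _) IH)).
  rewrite exprD exprS le_eqVlt; apply/orP; left; apply/eqP.
  by field; lra.
have un' n k : (n <= k)%N -> rnorm (u k - u n) <= c * q ^+ n / (1 - q).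
  move=> nk; rewrite -(subnKC nk); apply: (le_trans (un _ _)).
  rewrite ler_pM2r ?invr_gt0// ler_piMr ?mulr_ge0 ?exprn_ge0//.
  by rewrite gerBl exprn_ge0.
have small (e : R) : 0 < e -> exists N, c * q ^+ N / (1 - q) < e.
  move=> e0.
  have : (fun n => c / (1 - q) * q ^+ n) @ \oo --> (c / (1 - q) * 0)%R.
    apply: cvgM; first exact: cvg_cst.
    by apply: cvg_expr; rewrite ger0_norm.
  rewrite mulr0 => /cvgrPdist_lt /(_ _ e0)[N _ /(_ N (leqnn N))] /=.
  by rewrite sub0r normrN => /ltr_normlW; exists N; rewrite mulrAC.
have ue (e : R[i]) : 0 < e -> 0 < complex.Re e /\ e = (complex.Re e)%:C.
  by case: e => a b; rewrite ltcE /= => /andP[/eqP-> ->].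
have : cauchy (u @ \oo).
  apply: cauchy_exP => e /ue[e0 ->]; have [N Ne] := small _ e0.
  exists (u N); exists N => // n /= Nn; rewrite -ball_normE /=.
  rewrite distrC -rnormE ltcR; apply: le_lt_trans Ne; exact: un'.
move=> /cauchy_cvg ul; exists (lim (u @ \oo)) => n.
apply/ler_addgt0Pr => e e0.
have /cvgrPdist_lt/(_ e%:C) := ul; rewrite ltcR => /(_ e0)[N _ Ne].
have := Ne (maxn n N) (leq_maxr _ _); rewrite /= -rnormE ltcR => le.
rewrite -(subrK (u (maxn n N)) (lim _)) -addrA.
apply: (le_trans (rnormD _ _)); rewrite [leRHS]addrC lerD ?(ltW le)//.
by rewrite un' ?leq_maxl.
Qed.

End RealNorm.

Section HilbertModule.
Context {R : realType} {A : cstarAlgType R[i]} {X : hilbertModType A}.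
Implicit Types x y : X.

Lemma rnorm_inner x : rnorm (inner x x : A) = rnorm x ^+ 2.
Proof.
apply: complexI; rewrite rmorphXn /= !rnormE norm_inner.
by rewrite sqrtCK.
Qed.

Lemma inner_rnorm_eq x y : inner x x = inner y y :> A -> rnorm x = rnorm y.
Proof. by move=> e; apply: rnorm_eqP; rewrite !norm_inner e. Qed.

Lemma innerBr x y z : inner x (y - z) = inner x y - inner x z :> A.
Proof. by rewrite -scaleN1r innerDr innerZr scaleN1r. Qed.

(** Half of the polarization identity: combining [k = 1] with [k = 'i] eliminates [inner y x]. *)
Lemma inner_polar x y (k : R[i]) :
  inner (x + k *: y) (x + k *: y) - inner (x - k *: y) (x - k *: y)
    = (k *: inner x y + k^* *: inner y x) *+ 2 :> A.
Proof.
have P (l : R[i]) : inner (x + l *: y) (x + l *: y) =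
    (inner x x + (l^* * l) *: inner y y) + (l *: inner x y + l^* *: inner y x) :> A.
  rewrite innerDl !innerDr !innerZl !innerZr scalerA.
  by rewrite [_ *: _ + (_ * _) *: _]addrC addrACA.
rewrite -scaleNr !P rmorphN mulrNN /= !scaleNr -opprD.
by rewrite opprB addrC addrA subrK mulr2n.
Qed.


(* The constant 4 is what polarization gives; the sharp inequality, which needs
   the order of [A], is never used. *)
Lemma rnorm_inner_le x y : rnorm (inner x y : A) <= 4 * rnorm x * rnorm y.
Proof.
have unit : forall x y : X, rnorm x <= 1 -> rnorm y <= 1 -> rnorm (inner x y : A) <= 4.
  move=> {}x {}y x1 y1.
  (* Both vectors have norm at most 2, so each square contributes at most 4. *)
  have bd k : rnorm (k : R[i]) = 1 ->
     rnorm (inner (x + k *: y) (x + k *: y) - inner (x - k *: y) (x - k *: y) : A) <= 8.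
    move=> k1; apply: (le_trans (rnormB _ _)); rewrite !rnorm_inner.
    have := rnormD x (k *: y); have := rnormB x (k *: y).
    rewrite rnormZ k1 mul1r.
    have := rnorm_ge0 (x + k *: y); have := rnorm_ge0 (x - k *: y).
    by nra.
  have e : inner x y *+ 4 = (inner (x + 1 *: y) (x + 1 *: y) - inner (x - 1 *: y) (x - 1 *: y))
     - 'i *: (inner (x + 'i *: y) (x + 'i *: y) - inner (x - 'i *: y) (x - 'i *: y)) :> A.
    rewrite !inner_polar conjC1 conjCi !scale1r -scalerMnr scalerDr !scalerA mulrN.
    rewrite -expr2 sqrCi !scaleNr scale1r Algebra.opprK -mulrnBl opprD opprK.
    by rewrite scale1r addrACA subrr addr0 -mulr2n -mulrnA.
  have : rnorm (inner x y *+ 4 : A) <= 16.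
    rewrite e; apply: (le_trans (rnormB _ _)); rewrite rnormZ rnormi mul1r.
    have := bd 1 rnorm1; have := bd 'i rnormi; lra.
  rewrite -scaler_nat rnormZ -(rmorph_nat (real_complex R)) rnorm_real ger0_norm//.
  by move=> ?; lra.
have [->|x0] := eqVneq x 0; first by rewrite inner0l !rnorm0 mulr0 mul0r.
have [->|y0] := eqVneq y 0; first by rewrite inner0r !rnorm0 mulr0.
have px : 0 < rnorm x by rewrite lt_neqAle eq_sym rnorm_eq0 x0 rnorm_ge0.
have py : 0 < rnorm y by rewrite lt_neqAle eq_sym rnorm_eq0 y0 rnorm_ge0.
have n1 (z : X) : z != 0 -> rnorm ((rnorm z)^-1%:C *: z) <= 1.
  rewrite -rnorm_eq0 => z0; rewrite rnormZ rnorm_real.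
  by rewrite ger0_norm ?invr_ge0 ?rnorm_ge0// mulVf.
have := unit _ _ (n1 _ x0) (n1 _ y0).
rewrite innerZl innerZr !rnormZ rnorm_conj !rnorm_real !ger0_norm ?invr_ge0 ?rnorm_ge0//.
rewrite mulrA -invfM mulrC ler_pdivrMr ?mulrA ?[_ * rnorm y]mulrC//.
by rewrite mulr_gt0// lt_neqAle eq_sym rnorm_eq0 ?x0 ?y0 rnorm_ge0.
Qed.

HB.instance Definition _ (T : adjop X) :=
  GRing.isLinear.Build _ _ _ _ (adjfun T) (adjopP T).1.1.

(* A gliding hump: [T x_n] large yields a [y] at which all the functionals
   [<T x_n, .> = <x_n, T^* .>] are large, against [|<x_n, T^* y>| <= 4 |T^* y|]. *)
Lemma adjop_bounded (T : adjop X) :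
  exists c : R, forall x, rnorm (T x) <= c * rnorm x.
Proof.
apply: contrapT => /forallNP unbounded.
have /choice[x xP] n : exists x, rnorm x <= 1 /\ 32 ^+ n <= rnorm (T x).
  have /existsNP[x /negP] := unbounded (32 ^+ n).
  rewrite -ltNge => lt; exists ((rnorm x)^-1%:C *: x).
  have x0 : 0 < rnorm x.
    rewrite lt_neqAle rnorm_ge0 andbT eq_sym; apply/eqP => x0.
    move/eqP: x0; rewrite rnorm_eq0 => /eqP x0.
    by move: lt; rewrite x0 linear0 !rnorm0 mulr0 ltxx.
  rewrite linearZ /= !rnormZ rnorm_real ger0_norm ?invr_ge0 ?rnorm_ge0//.
  rewrite mulVf ?gt_eqF//; split=> //.
  by rewrite [_ * rnorm (T x)]mulrC ler_pdivlMr// ltW.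
pose t n := rnorm (T (x n)).
have t0 n : 0 < t n.
  by apply: lt_le_trans (xP n).2; rewrite exprn_gt0.
pose e n : X := (16^-1 ^+ n / t n)%:C *: T (x n).
pose phi n y := rnorm (inner (T (x n)) y : A).
(* The values of [<T x_m, .>] at [y m + e m] and [y m - e m] differ by an element of norm
   [2 * 16^-m * t m], so at least one of them has norm [16^-m * t m] or more. *)
pose y := fix y n : X := if n is m.+1 then
  if 16^-1 ^+ m * t m <= phi m (y m + e m) then y m + e m else y m - e m
  else 0.
have ye n : rnorm (y n.+1 - y n) <= 1 * 16^-1 ^+ n.
  have -> : 1 * 16^-1 ^+ n = rnorm (e n).
    rewrite /e rnormZ rnorm_real ger0_norm ?divr_ge0 ?exprn_ge0 ?(ltW (t0 _))//.
    by rewrite mul1r divfK// gt_eqF.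
  by rewrite /=; case: ifP => _; rewrite [y n + _]addrC addrK// rnormN.
have phiy n : 16^-1 ^+ n * t n <= phi n (y n.+1).
  rewrite /=; case: ifP => // /negbT; rewrite -ltNge => lt.
  have : rnorm (inner (T (x n)) (y n + e n) - inner (T (x n)) (y n - e n) : A)
     = 2 * (16^-1 ^+ n * t n).
    rewrite innerDr innerBr opprB addrC addrA subrK -mulr2n -scaler_nat rnormZ.
    rewrite -(rmorph_nat (real_complex R)) rnorm_real ger0_norm//.
    rewrite /e innerZr rnormZ rnorm_inner rnorm_real ger0_norm; last first.
      by rewrite divr_ge0 ?exprn_ge0 ?(ltW (t0 _)).
    by rewrite -/(t n); congr (_ * _); rewrite expr2 mulrA divfK ?gt_eqF//.
  have := rnormB (inner (T (x n)) (y n + e n) : A) (inner (T (x n)) (y n - e n)).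
  by move: lt; rewrite /phi; lra.
have [|l lP] := @rnorm_cvg _ _ y 1 16^-1 _ ye; first lra.
(* The increments after [y n.+1] add up to at most [16^-n / 15], which costs at most [4/15] of the
   lower bound [16^-n * t n]; and [t n >= 32^n]. *)
have phil n : 2 ^+ n * (11 / 15) <= 4 * rnorm (adjoint T l).
  have -> : 2 ^+ n * (11 / 15) = 16^-1 ^+ n * 32 ^+ n * (11 / 15) :> R.
    by rewrite -exprMn; congr (_ ^+ _ * _); lra.
  have : phi n l <= 4 * rnorm (adjoint T l).
    rewrite /phi adjointP; apply: (le_trans (rnorm_inner_le _ _)).
    by rewrite ler_wpM2r ?rnorm_ge0// ler_piMr// (xP n).1.
  apply: le_trans.
  have : phi n (y n.+1) <= phi n l + 4 * t n * rnorm (l - y n.+1).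
    rewrite /phi -[in leLHS](subKr l (y n.+1)) innerBr.
    apply: (le_trans (rnormB _ _)); rewrite lerD2l.
    exact: rnorm_inner_le.
  have := phiy n; have := lP n.+1; rewrite mul1r exprS.
  have := (xP n).2; rewrite -/(t n); have := t0 n.
  have : 0 < 16^-1 ^+ n :> R by rewrite exprn_gt0.
  move: (16^-1 ^+ n) (32 ^+ n) (t n) => p q s p0 s0 qs lP' h1 h2.
  have h3 : s * rnorm (l - y n.+1) <= s * (p / 15).
    rewrite ler_pM2l//; apply: (le_trans lP').
    by have -> : 16^-1 * p / (1 - 16^-1) = p / 15 by field.
  by nra.
set c := 4 * _ in phil.
have c0 : 0 <= c by rewrite mulr_ge0 ?rnorm_ge0.
have [n cn] : exists n, 2 * c < n%:R :> R.
  by exists (Num.truncn (2 * c)).+1; exact: truncnS_gt.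
have : n%:R <= 2 ^+ n :> R by rewrite -natrX ler_nat ltnW// ltn_expl.
by move: (phil n) cn; move: (2 ^+ n) (n%:R : R) => a b; lra.
Qed.

End HilbertModule.

(** * Cauchy's estimate and Liouville's theorem *)

Section CauchyEstimate.
Context {R : realType}.

(** ['X^n - 1] splits and is separable, so there are [n] distinct roots of unity, and these include
    a primitive one. *)
Lemma prim_root_exists (F : numClosedFieldType) n :
  (0 < n)%N -> exists z : F, n.-primitive_root z.
Proof.
move=> n0; have [r Dp] := closed_field_poly_normal ('X^n - 1 : {poly F}).
rewrite (monicP _) ?monicXnsubC// scale1r in Dp.
have rn1 : all n.-unity_root r by apply/allP=> z; rewrite -root_prod_XsubC -Dp.
have sz_r : (n < (size r).+1)%N.
  by rewrite -(size_prod_XsubC r id) -Dp size_XnsubC.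
have [|z _ zP] := hasP (has_prim_root n0 rn1 _ sz_r); last by exists z.
by rewrite -separable_prod_XsubC -Dp separable_Xn_sub_1// pnatr_eq0 -lt0n.
Qed.

Lemma sum_prim_root (F : fieldType) m (w : F) k : m.-primitive_root w ->
  \sum_(j < m) w ^+ (j * k) = (if (m %| k)%N then m%:R else 0).
Proof.
move=> wP; under eq_bigr do rewrite mulnC exprM.
have [dv|ndv] := ifPn.
  rewrite (eqP (_ : w ^+ k == 1)) -?(prim_order_dvd wP)//.
  under eq_bigr do rewrite expr1n.
  by rewrite sumr_const card_ord.
have : w ^+ k - 1 != 0 by rewrite subr_eq0 -(prim_order_dvd wP).
move=> /mulfI; apply; rewrite mulr0 -subrX1 -exprM mulnC exprM.
by rewrite (prim_expr_order wP) expr1n subrr.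
Qed.

(* Averaging [w^-j f(r w^j)] over the [m]-th roots of unity [w^j] isolates
   [r c_1]. *)
Lemma cauchy_estimate (V : normedModType R[i]) m (c : nat -> V) (r C : R) :
  (1 < m)%N -> 0 <= r ->
  (forall z : R[i], rnorm z = r -> rnorm (\sum_(k < m) z ^+ k *: c k) <= C) ->
  r * rnorm (c 1%N) <= C.
Proof.
move=> m1 r0 bd; have m0 := ltnW m1.
have [w wP] := @prim_root_exists R[i] m m0.
have w1 : rnorm w = 1.
  apply: complexI; rewrite rnormE; apply/eqP.
  rewrite -(@pexpr_eq1 _ _ m)// -normrX; by rewrite (prim_expr_order wP) normr1.
(* [w ^+ (j * m.-1)] stands for [w^-j]. Once the sums are exchanged, only the [k < m] with
   [m %| m.-1 + k] survives, that is [k = 1]. *)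
have e : (m%:R * r%:C) *: c 1%N =
    \sum_(j < m) w ^+ (j * m.-1) *: \sum_(k < m) (r%:C * w ^+ j) ^+ k *: c k.
  under eq_bigr do rewrite scaler_sumr.
  rewrite exchange_big /= (bigD1 (Ordinal m1))//= [X in _ + X]big1 => [|k km].
    under eq_bigr => j _ do rewrite scalerA expr1 mulrCA -exprD -mulnSr prednK//.
    rewrite addr0 -scaler_suml -mulr_sumr sum_prim_root// dvdnn.
    by rewrite mulrC.
  under eq_bigr => j _ do
    rewrite scalerA exprMn -exprM mulrCA -exprD -mulnDr.
  rewrite -scaler_suml -mulr_sumr sum_prim_root// ifN ?mulr0 ?scale0r//.
  apply: contra km => /dvdnP[q]; rewrite -val_eqE /=.
  by have := ltn_ord k; case: q => [|[|q]] /=; lia.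
have : rnorm ((m%:R * r%:C) *: c 1%N) <= m%:R * C.
  rewrite e; apply: (le_trans (rnorm_sum _ _)).
  have -> : m%:R * C = \sum_(j < m) C by rewrite sumr_const card_ord mulr_natl.
  apply: ler_sum => j _; rewrite rnormZ rnormX w1 expr1n mul1r.
  by apply: bd; rewrite rnormM rnormX w1 expr1n mulr1 rnorm_real ger0_norm.
rewrite rnormZ rnormM -(rmorph_nat (real_complex R)) !rnorm_real !ger0_norm//.
by rewrite -mulrA ler_pM2l// ltr0n.
Qed.

End CauchyEstimate.

(** * The ring of adjointable operators and Liouville's theorem for it *)

Section OperatorAlgebra.
Context {R : realType} {A : cstarAlgType R[i]} {X : hilbertModType A}.
Implicit Types (x y : X) (S T B C D : adjop X) (z : R[i]).

Lemma id_adjointable : (id : X -> X) \in adjointable (X := X).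
Proof. by apply/mem_set; split=> //; exists id. Qed.

Definition idop : adjop X := AdjOp id_adjointable.

Lemma idop_compl : left_id idop (@adjcomp _ _ X).
Proof. by move=> S; apply: adjop_eq. Qed.

Lemma idop_compr : right_id idop (@adjcomp _ _ X).
Proof. by move=> S; apply: adjop_eq. Qed.

Lemma adjcomp_left_distributive : left_distributive (@adjcomp _ _ X) +%R.
Proof. by move=> S T U; rewrite adjcompDl. Qed.

Lemma adjcomp_right_distributive : right_distributive (@adjcomp _ _ X) +%R.
Proof. by move=> S T U; rewrite adjcompDr. Qed.

(** The ring structure is one that allows [1 = 0], since [X] may be the zero module. *)
HB.instance Definition _ := GRing.Zmodule_isPzRing.Build (adjop X)
  (@adjcompA _ _ X) idop_compl idop_compr adjcomp_left_distributive adjcomp_right_distributive.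

Lemma amulE S T : S ** T = S * T. Proof. by []. Qed.

Lemma opME S T x : (S * T) x = S (T x). Proof. by []. Qed.

Lemma opBE S T x : (S - T) x = S x - T x. Proof. by []. Qed.

Lemma opNE S x : (- S) x = - S x. Proof. by []. Qed.

Lemma opZl z S T : (z *: S) * T = z *: (S * T). Proof. exact: adjcompZl. Qed.

Lemma opZr z S T : S * (z *: T) = z *: (S * T). Proof. exact: adjcompZr. Qed.

Lemma opMstar S T : star (S * T) = star T * star S. Proof. exact: starM. Qed.

Lemma star_adjP T x y : inner (T x) y = inner x (star T y) :> A.
Proof. exact: adjointP. Qed.

Lemma star1 : star (1 : adjop X) = 1.
Proof. by apply: esym; apply: adjoint_unique. Qed.

Lemma starB S T : star (S - T) = star S - star T.
Proof. by rewrite starD -scaleN1r starZ rmorphN1 scaleN1r. Qed.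

Lemma starX S n : star (S ^+ n) = star S ^+ n.
Proof. by elim: n => [|n IH]; rewrite ?star1// exprS opMstar IH -exprSr. Qed.

Lemma op_sumE (I : Type) (s : seq I) (F : I -> adjop X) x :
  (\sum_(i <- s) F i) x = \sum_(i <- s) F i x.
Proof. by elim/big_rec2: _ => // i y S _ <-. Qed.

(** The coefficients are an eventually zero sequence, so that the coefficients 0 and 1 make sense
    whatever [m] is. *)
Definition op_poly (F : R[i] -> adjop X) (c : nat -> adjop X) m :=
  (forall k, (m <= k)%N -> c k = 0) /\
  forall z, F z = \sum_(k < m) z ^+ k *: c k.

Definition first_order (F : R[i] -> adjop X) a b :=
  exists c m, [/\ op_poly F c m, c 0%N = a & c 1%N = b].

Lemma first_order_cst D : first_order (fun=> D) D 0.
Proof.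
exists (fun k => if k is 0%N then D else 0), 1%N; split=> //; split=> [[]//|z].
by rewrite big_ord1 scale1r.
Qed.

Lemma first_order_mull B F a b :
  first_order F a b ->
  first_order (fun z => (1 + z *: B) * F z) a (b + B * a).
Proof.
move=> [c [m [[c0 cF] ca cb]]].
exists (fun k => c k + (if k is j.+1 then B * c j else 0)), m.+1.
split; rewrite ?ca ?cb ?addr0//; split=> [[|k]//= km|z].
  by rewrite !c0 ?mulr0 ?addr0// ltnW.
under [RHS]eq_bigr do rewrite scalerDr; rewrite big_split /=.
rewrite big_ord_recr /= (c0 m)// scaler0 addr0 -cF big_ord_recl /= scaler0 add0r.
rewrite mulrDl mul1r opZl {2}cF mulr_sumr scaler_sumr; congr (_ + _).
by apply: eq_bigr => i _; rewrite opZr scalerA -exprS.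
Qed.

Lemma first_order_mulr C F a b :
  first_order F a b ->
  first_order (fun z => F z * (1 + z *: C)) a (b + a * C).
Proof.
move=> [c [m [[c0 cF] ca cb]]].
exists (fun k => c k + (if k is j.+1 then c j * C else 0)), m.+1.
split; rewrite ?ca ?cb ?addr0//; split=> [[|k]//= km|z].
  by rewrite !c0 ?mul0r ?addr0// ltnW.
under [RHS]eq_bigr do rewrite scalerDr; rewrite big_split /=.
rewrite big_ord_recr /= (c0 m)// scaler0 addr0 -cF big_ord_recl /= scaler0 add0r.
rewrite mulrDr mulr1 opZr {2}cF mulr_suml scaler_sumr; congr (_ + _).
by apply: eq_bigr => i _; rewrite opZl scalerA -exprS.
Qed.

(** By the product rule, each new pair of outer factors adds [B * D + D * C] to the derivative at
    0. *)
Lemma first_order_exp B D C n :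
  first_order (fun z => (1 + z *: B) ^+ n * D * (1 + z *: C) ^+ n) D
    ((B * D + D * C) *+ n).
Proof.
elim: n => [|n IH].
  have [c [m [[c0 cF] ca cb]]] := first_order_cst D.
  by exists c, m; split=> //; split=> // z; rewrite !expr0 mul1r mulr1 (cF z).
have [c [m [[c0 cF] ca cb]]] := first_order_mulr C (first_order_mull B IH).
exists c, m; split=> //; first split=> // z.
  by rewrite exprS exprSr !mulrA -cF !mulrA.
by rewrite cb mulrSr addrA.
Qed.

(* Liouville's theorem for [z |-> exp (z B) D exp (z C) x], with the
   exponentials replaced by the polynomials [(1 + z B / n) ^ n]. *)
Lemma op_liouville B D C x (K : R) :
  (forall r : R, 0 < r -> exists n, (0 < n)%N /\ forall z, rnorm z = r ->
     rnorm (((1 + (z / n%:R) *: B) ^+ n * D * (1 + (z / n%:R) *: C) ^+ n) x)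
       <= K) ->
  (B * D + D * C) x = 0.
Proof.
move=> bd; apply/eqP; rewrite -rnorm_eq0 eq_le rnorm_ge0 andbT.
set v := _ x.
have rv (r : R) : 0 < r -> r * rnorm v <= K.
  move=> r0; have [n [n0 nP]] := bd r r0.
  have [c [m [[c0 cF] ca cb]]] := first_order_exp (n%:R^-1 *: B) D (n%:R^-1 *: C) n.
  have nz : n%:R != 0 :> R[i] by rewrite pnatr_eq0 -lt0n.
  have cv : v = c 1%N x.
    rewrite cb opZl opZr -scalerDr -scaler_nat scalerA mulfV// scale1r //.
  (* Two zero coefficients are appended because Cauchy's estimate asks for at least two terms. *)
  rewrite cv; apply: (@cauchy_estimate _ _ m.+2 (fun k => c k x)) => //.
    exact: ltW.
  move=> z zr; apply: le_trans (nP z zr); rewrite le_eqVlt; apply/orP; left.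
  have := cF z; rewrite !scalerA => ->; rewrite op_sumE !big_ord_recr /=.
  have c0x j : (m <= j)%N -> c j x = 0 by move=> /c0->.
  by rewrite !c0x// !scaler0 !addr0.
rewrite leNgt; apply/negP => v0.
have K0 : 0 <= K by apply: le_trans (rv 1 ltr01); rewrite mul1r ltW.
have := rv ((K + 1) / rnorm v).
rewrite divfK ?gt_eqF// divr_gt0 ?ltr_wpDl// => /(_ isT); lra.
Qed.

End OperatorAlgebra.

(** * The Fuglede-Putnam theorem *)

(** The power is at most [exp (c / n)], hence at most [exp 1] as soon as [n >= c]. *)
Lemma exp_quadratic_small (R : realType) (c : R) : 0 <= c ->
  exists n, (0 < n)%N /\ (1 + c / n%:R ^+ 2) ^+ n <= expR 1.
Proof.
move=> c0; have [n cn] : exists n, c <= n.+1%:R :> R.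
  by exists (Num.truncn c); apply/ltW/truncnS_gt.
have n0 : 0 < n.+1%:R :> R by rewrite ltr0n.
exists n.+1; split=> //; apply: (@le_trans _ _ (expR (c / n.+1%:R ^+ 2) ^+ n.+1)).
  apply: lerXn2r; rewrite ?nnegrE ?expR_ge0 ?expR_ge1Dx//.
  by rewrite addr_ge0// divr_ge0// exprn_ge0// ltW.
rewrite -expRM_natl ler_expR.
by rewrite mulrA ler_pdivrMr ?exprn_gt0// mul1r expr2 ler_pM2l.
Qed.

Section FugledePutnam.
Context {R : realType} {A : cstarAlgType R[i]} {X : hilbertModType A}.
Implicit Types (x y : X) (S T B C D G H M N : adjop X) (a z : R[i]).

Definition opbound (b : R) T := forall x, rnorm (T x) <= b * rnorm x.

Lemma ex_opbound T : exists b, 0 <= b /\ opbound b T.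
Proof.
have [c cP] := adjop_bounded T; exists (Num.max 0 c); split=> [|x].
  by rewrite le_max lexx.
by apply: le_trans (cP x) _; rewrite ler_wpM2r ?rnorm_ge0// le_max lexx orbT.
Qed.

Lemma opboundX b T n : 0 <= b -> opbound b T -> opbound (b ^+ n) (T ^+ n).
Proof.
move=> b0 Tb; elim: n => [|n IH] x; first by rewrite !expr0 mul1r.
rewrite !exprS opME -mulrA; apply: le_trans (Tb _) _.
by rewrite ler_wpM2l.
Qed.

Lemma comm_scale a B C : GRing.comm B C -> GRing.comm B (a *: C).
Proof. by rewrite /GRing.comm opZr opZl => ->. Qed.

Lemma normal_rnorm G x : normal G -> rnorm (G x) = rnorm (star G x).
Proof.
move=> nG; apply: inner_rnorm_eq.
by rewrite !star_adjP starK -!opME -!amulE nG.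
Qed.

(** The product is [(1 - a^2 B^2)^n]: the approximations of [exp (n a B)] and [exp (- n a B)] are
    inverse to each other up to second order, and [exp_quadratic_small] controls the defect. *)
Lemma opbound_conj_exp b B a n : 0 <= b -> opbound b B ->
  opbound ((1 + rnorm a ^+ 2 * b ^+ 2) ^+ n)
    ((1 + a *: B) ^+ n * (1 - a *: B) ^+ n).
Proof.
move=> b0 Bb; have cc : GRing.comm (1 + a *: B) (1 - a *: B).
  by apply: commrB; [exact: commr1 | apply: commr_sym; apply: commrD; [exact: commr1|]].
rewrite -(exprMn_comm n cc).
apply: opboundX; first by rewrite addr_ge0// mulr_ge0// sqr_ge0.
have -> : (1 + a *: B) * (1 - a *: B) = 1 - a ^+ 2 *: (B * B).
  by rewrite mulrBr mulr1 mulrDl mul1r opprD addrA addrK opZl opZr scalerA.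
move=> x; rewrite opBE adjopZ; apply: le_trans (rnormB _ _) _.
rewrite mulrDl mul1r lerD2l rnormZ rnormX -mulrA.
rewrite ler_wpM2l ?sqr_ge0// opME expr2 -mulrA.
by apply: le_trans (Bb _) _; rewrite ler_wpM2l.
Qed.

Lemma intertwineX B C T n : B * T = T * C -> B ^+ n * T = T * C ^+ n.
Proof.
move=> BT; elim: n => [|n IH]; first by rewrite !expr0 mul1r mulr1.
by rewrite exprSr -mulrA BT mulrA IH exprSr mulrA.
Qed.

Lemma normal_exp N a n : normal N -> normal ((1 + a *: N) ^+ n).
Proof.
move=> nN; rewrite /normal !amulE starX.
apply: commrX; apply: commr_sym; apply: commrX; apply: commr_sym.
rewrite starD star1 starZ; apply: commrD; first exact: commr1.
apply: comm_scale; apply: commr_sym; apply: commrD; first exact: commr1.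
by apply: comm_scale; exact: commr_sym.
Qed.

(* Write [N'], [M'] for the adjoints.  For [a = z / n] and
   [y = (1 - a M')^n x], normality gives
   [|(1 + a N')^n T y| = |(1 + conj a N)^n T y| = |T (1 + conj a M)^n y|
     <= |T| |(1 + a M')^n y|], and [(1 + a M')^n y = (1 - a^2 M'^2)^n x]. *)
Lemma fuglede_putnam N M T : normal N -> normal M ->
  N * T = T * M -> star N * T = T * star M.
Proof.
move=> nN nM NT; have [t [t0 Tt]] := ex_opbound T.
have [m [m0 Mm]] := ex_opbound (star M).
apply/eqP; rewrite -subr_eq0 -mulrN; apply/eqP/adjop_eq => x.
apply: (@op_liouville _ _ _ _ _ _ _ (t * (expR 1 * rnorm x))) => r r0.
have [|n [n0 nP]] := @exp_quadratic_small _ (r ^+ 2 * m ^+ 2).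
  by rewrite mulr_ge0 ?sqr_ge0.
exists n; split=> // z zr; set a := z / n%:R.
have ar : rnorm a ^+ 2 * m ^+ 2 = r ^+ 2 * m ^+ 2 / n%:R ^+ 2.
  rewrite /a -(rmorph_nat (real_complex R)) -fmorphV rnormM rnorm_real zr.
  by rewrite ger0_norm ?invr_ge0// exprMn exprVn mulrAC.
have aM := @opbound_conj_exp _ _ a n m0 Mm x; rewrite ar in aM.
rewrite opME in aM; rewrite scalerN -mulrA !opME.
set y : X := adjfun (_ ^+ n) x in aM *.
have SB : star ((1 + a^* *: N) ^+ n) = (1 + a *: star N) ^+ n.
  by rewrite starX starD star1 starZ conjCK.
rewrite -SB -normal_rnorm; last exact: normal_exp.
rewrite -opME (@intertwineX _ (1 + a^* *: M)); last first.
  by rewrite mulrDl mulrDr mul1r mulr1 opZl opZr NT.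
rewrite opME; apply: le_trans (Tt _) _; rewrite ler_wpM2l//.
rewrite normal_rnorm; last exact: normal_exp.
rewrite starX starD star1 starZ conjCK.
by apply: le_trans aM _; rewrite ler_wpM2r ?rnorm_ge0.
Qed.

End FugledePutnam.

(** * Positive operators *)

Lemma geometric_small (R : realType) (w e : R) : 0 < e ->
  exists k, w * (2 * 2^-1 ^+ k) <= e.
Proof.
move=> e0; have [n ne] : exists n, 2 * w / e < n%:R :> R.
  by exists (Num.truncn (2 * w / e)).+1; exact: truncnS_gt.
exists n; have : n%:R <= 2 ^+ n :> R by rewrite -natrX ler_nat ltnW// ltn_expl.
rewrite mulrA exprVn ler_pdivrMr ?exprn_gt0//.
move: ne; rewrite ltr_pdivrMr// => ne n2.
by have := ler_wpM2r (ltW e0) n2; lra.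
Qed.

Section PositiveOperators.
Context {R : realType} {A : cstarAlgType R[i]} {X : hilbertModType A}.
Implicit Types (x y : X) (S T B C D G J P W Y Z : adjop X) (a z : R[i]) (b c t : R).

Local Notation I := (1 : adjop X).

Lemma opboundW b c T : b <= c -> opbound b T -> opbound c T.
Proof.
by move=> bc Tb x; apply: le_trans (Tb x) _; rewrite ler_wpM2r// rnorm_ge0.
Qed.

Lemma opboundD b c S T : opbound b S -> opbound c T -> opbound (b + c) (S + T).
Proof.
move=> Sb Tc x; rewrite adjopD; apply: le_trans (rnormD _ _) _.
by rewrite mulrDl lerD.
Qed.

Lemma opboundM b c S T : 0 <= b -> opbound b S -> opbound c T ->
  opbound (b * c) (S * T).
Proof.
move=> b0 Sb Tc x; rewrite opME; apply: le_trans (Sb _) _.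
by rewrite -mulrA ler_wpM2l.
Qed.

Lemma opboundZ b a T : opbound b T -> opbound (rnorm a * b) (a *: T).
Proof.
by move=> Tb x; rewrite adjopZ rnormZ -mulrA ler_wpM2l ?rnorm_ge0.
Qed.

Lemma opboundN b T : opbound b T -> opbound b (- T).
Proof. by move=> Tb x; rewrite opNE rnormN. Qed.

Lemma opbound1 : opbound 1 (1 : adjop X).
Proof. by move=> x; rewrite mul1r. Qed.

Lemma conjC_realc t : Num.conj t%:C = t%:C.
Proof. by apply/eqP; rewrite -CrealE realE !lecR le_total. Qed.

Lemma rnorm_2V : rnorm (2^-1 : R[i]) = 2^-1.
Proof.
by rewrite -(rmorph_nat (real_complex R)) -fmorphV rnorm_real ger0_norm.
Qed.

(* [C = 1 - b_k] for the iteration [b_0 = 0], [b_{k+1} = (Y + b_k^2) / 2]: the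
   error [C^2 - (1 - Y)] is [2 (b_{k+1} - b_k)]. *)
Lemma approx_sqrt Y k : star Y = Y -> opbound (2^-1) Y ->
  exists C, [/\ star C = C, forall Z, GRing.comm Z Y -> GRing.comm Z C,
    opbound 2 C & opbound (2 * 2^-1 ^+ k) (C * C - (1 - Y))].
Proof.
move=> sY Yb.
pose b := fix b n : adjop X := if n is m.+1 then 2^-1 *: (Y + b m * b m) else 0.
have b_star n : star (b n) = b n.
  elim: n => [|n IH] /=; first by apply: (addrI (star 0)); rewrite -starD !addr0.
  rewrite starZ starD opMstar IH sY; congr (_ *: _).
  by rewrite -(rmorph_nat (real_complex R)) -fmorphV conjC_realc.
have b_comm n Z : GRing.comm Z Y -> GRing.comm Z (b n).
  move=> ZY; elim: n => [|n IH] /=; first exact: commr0.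
  by apply: comm_scale; apply: commrD => //; apply: commrM.
(* The ball of radius 1/2 is preserved because [(1/2 + 1/4) / 2 <= 1/2]. *)
have b_bound n : opbound (2^-1) (b n).
  elim: n => [|n IH] /=.
    by move=> x; change (rnorm (0 : X) <= 2^-1 * rnorm x); rewrite rnorm0 mulr_ge0 ?rnorm_ge0.
  apply: opboundW (opboundZ _ (opboundD Yb (opboundM _ IH IH))) => //.
  by rewrite rnorm_2V; lra.
have b_diff n : opbound (2^-1 ^+ n) (b n.+1 - b n).
  elim: n => [|n IH].
    rewrite subr0 expr0; apply: opboundW (b_bound 1%N); lra.
  (* The iterates commute, so the difference of squares factors. The sum of two iterates has norm at
     most 1, and the prefactor 1/2 gives the contraction. *)
  have -> : b n.+2 - b n.+1 = 2^-1 *: ((b n.+1 + b n) * (b n.+1 - b n)).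
    have bb : b n.+1 * b n = b n * b n.+1.
      apply: (b_comm n); apply: commr_sym; exact: (b_comm n.+1).
    rewrite mulrDl !mulrBr -bb addrA subrK.
    rewrite [b n.+2]/= [X in _ - X]/= -/(b n.+1) -scalerBr.
    by rewrite opprD addrACA subrr add0r.
  have q0 : 0 <= 2^-1 ^+ n :> R by rewrite exprn_ge0.
  apply: opboundW (opboundZ _ (opboundM _ (opboundD (b_bound n.+1) (b_bound n)) IH)).
    by rewrite rnorm_2V exprS; lra.
  by rewrite addr_ge0.
exists (1 - b k); split.
- by rewrite starB star1 b_star.
- by move=> Z ZY; apply: commrB; [exact: commr1 | exact: b_comm].
- apply: opboundW (opboundD opbound1 (opboundN (b_bound k))); lra.
- have -> : (1 - b k) * (1 - b k) - (1 - Y) = 2 *: (b k.+1 - b k).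
    rewrite scalerBr /= scalerA mulfV ?pnatr_eq0// scale1r.
    rewrite mulrBl mul1r mulrBr mulr1 (_ : _ *: b k = b k + b k); last first.
      by rewrite scaler_nat mulr2n.
    by rewrite !opprB addrC !addrA subrK -addrA addrACA -opprD.
  have := opboundZ 2 (b_diff k).
  by rewrite -(rmorph_nat (real_complex R)) rnorm_real ger0_norm.
Qed.

(** A substitute for positivity that avoids exact square roots. Commutation of [B] with [W] is what
    makes a product of two approximate roots self-adjoint in [approx_square_step]. *)
Definition approx_square W := forall eta : R, 0 < eta ->
  exists B, [/\ star B = B, GRing.comm B W & opbound eta (B * B - W)].

Lemma real_scale_star t : star (t%:C *: I) = t%:C *: I.
Proof. by rewrite starZ star1 conjC_realc. Qed.

Lemma comm_real_scale B t : GRing.comm B (t%:C *: I).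
Proof. by apply: comm_scale; apply: commr1. Qed.

(* [B^2 + s = (B + i sqrt s) (B - i sqrt s)], the two factors are adjoint and
   normal, hence increase the norm equally; and they differ by [2 i sqrt s]. *)
Lemma approx_square_lower W t x : approx_square W -> 0 <= t ->
  t * rnorm x <= rnorm ((W + t%:C *: I) x).
Proof.
move=> Wsq t0; set s := Num.sqrt t.
have ss : t = s * s by rewrite -expr2 sqr_sqrtr.
have s0 : 0 <= s by rewrite sqrtr_ge0.
have lowB B : star B = B -> t * rnorm x <= rnorm ((B * B + t%:C *: I) x).
  move=> sB; pose G := B + ('i * s%:C) *: I.
  have sG : star G = B - ('i * s%:C) *: I.
    by rewrite starD sB starZ star1 rmorphM /= conjCi conjC_realc mulNr scaleNr.
  have GG : B * B + t%:C *: I = G * star G.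
    rewrite sG mulrDl !mulrBr !(opZl, opZr) !(mul1r, mulr1) scalerA.
    have -> : 'i * s%:C * ('i * s%:C) = - t%:C :> R[i].
      by rewrite mulrACA -expr2 sqrCi mulN1r -rmorphM -ss.
    by rewrite scaleNr opprK addrA subrK.
  have nG : normal G.
    rewrite /normal !amulE sG /G; apply: commr_sym; apply: commrB.
      apply: commr_sym; apply: commrD; first exact: commr_refl.
      by apply: comm_scale; exact: commr1.
    by apply: comm_scale; exact: commr1.
  have lowG y : s * rnorm y <= rnorm (G y).
    have e : ('i * s%:C) *: y *+ 2 = G y - star G y.
      rewrite sG -opBE opprB addrC addrA subrK.
      by rewrite mulr2n.
    have : rnorm (('i * s%:C) *: y *+ 2) <= rnorm (G y) *+ 2.
      by rewrite e [leRHS]mulr2n {2}normal_rnorm// rnormB.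
    rewrite -scaler_nat !rnormZ rnormM rnormi mul1r rnorm_real.
    rewrite -(rmorph_nat (real_complex R)) rnorm_real !ger0_norm//.
    lra.
  rewrite GG opME ss -mulrA; apply: le_trans (lowG _); rewrite ler_wpM2l//.
  by rewrite -normal_rnorm.
have [->|x0] := eqVneq x 0; first by rewrite rnorm0 mulr0 rnorm_ge0.
have px : 0 < rnorm x by rewrite lt_neqAle eq_sym rnorm_eq0 x0 rnorm_ge0.
apply/ler_addgt0Pr => e e0; have [|B [sB _ Bb]] := Wsq (e / rnorm x).
  by rewrite divr_gt0.
apply: le_trans (lowB B sB) _.
have -> : B * B + t%:C *: I = (W + t%:C *: I) + (B * B - W).
  by rewrite addrAC [W + _]addrC subrK.
rewrite adjopD; apply: le_trans (rnormD _ _) _; rewrite lerD2l.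
by apply: le_trans (Bb _) _; rewrite divfK// gt_eqF.
Qed.

(* [W - t = W (1 - t J)]: multiply approximate square roots of [W] and of
   [1 - t J]. *)
Lemma approx_square_step W J : approx_square W -> star W = W ->
  W * J = 1 -> J * W = 1 ->
  exists2 d : R, 0 < d &
    forall t, 0 <= t -> t <= d -> approx_square (W - t%:C *: I).
Proof.
move=> Wsq sW WJ JW.
have sJ : star J = J.
  have : star J * W = 1 by rewrite -{1}sW -opMstar WJ star1.
  by move=> /(congr1 ( *%R^~ J)); rewrite -mulrA WJ mulr1 mul1r.
have [c [c0 Jc]] := ex_opbound J; have [w [w0 Ww]] := ex_opbound W.
(* With this bound on [t], the norm of [t J] is at most 1/2, as [approx_sqrt] requires. *)
exists (2 * (c + 1))^-1; first by rewrite invr_gt0; lra.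
move=> t t0 td eta eta0; pose Y := t%:C *: J.
have sY : star Y = Y by rewrite starZ conjC_realc sJ.
have Yb : opbound (2^-1) Y.
  apply: opboundW (opboundZ _ Jc); rewrite rnorm_real ger0_norm//.
  have c1 : 0 < 2 * (c + 1) by lra.
  have : t * (2 * (c + 1)) <= 1 by rewrite -ler_pdivlMr// div1r.
  by nra.
(* [C * C] has norm at most 4, so the error of [B] contributes [eta / 2]; the error of [C] gets the
   other half. *)
have [B [sB BW Bb]] := Wsq (eta / 8) ltac:(lra).
have [k kP] : exists k, w * (2 * 2^-1 ^+ k) <= eta / 2.
  by apply: geometric_small => //; rewrite divr_gt0.
have [C [sC CY C2 Cb]] := approx_sqrt k sY Yb.
have BJ : GRing.comm B J.
  have : J * (B * W) * J = J * (W * B) * J by rewrite BW.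
  by rewrite -!mulrA WJ mulr1 !mulrA JW mul1r.
have BC : GRing.comm B C by apply: CY; apply: comm_scale.
have WC : GRing.comm W C.
  by apply: CY; apply: comm_scale; rewrite /GRing.comm WJ JW.
exists (B * C); split.
- by rewrite opMstar sB sC BC.
- apply: commrB; last exact: comm_real_scale.
  by apply: commr_sym; apply: commrM => //; apply: commr_sym.
have -> : B * C * (B * C) - (W - t%:C *: I) =
    (B * B - W) * (C * C) + W * (C * C - (1 - Y)).
  have WY : W * Y = t%:C *: I by rewrite /Y opZr WJ.
  rewrite -WY mulrBl mulrBr mulrBr mulr1 addrA subrK; congr (_ - _).
  by rewrite mulrA -[B * C * B]mulrA -BC !mulrA.
apply: opboundW (opboundD (opboundM _ Bb (opboundM _ C2 C2)) (opboundM w0 Ww Cb)) => //; lra.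
Qed.

(** Continuity method on the set [E] of good shifts [t > 0]: it contains a large [t], where
    [P + t = t (1 + P / t)]; its infimum is still good, and a positive infimum could be lowered by
    [approx_square_step]. *)
Lemma approx_square_of_inverses P : star P = P ->
  (forall t, 0 < t ->
     exists J, (P + t%:C *: I) * J = 1 /\ J * (P + t%:C *: I) = 1) ->
  approx_square P.
Proof.
move=> sP Pinv; have [p [p0 Pp]] := ex_opbound P.
pose E : set R := [set t | 0 < t /\ approx_square (P + t%:C *: I)].
have E0 : E !=set0.
  pose t := 2 * (p + 1); have t0 : 0 < t by rewrite /t; lra.
  exists t; split=> // eta eta0; pose Y := - (t^-1%:C *: P).
  have sY : star Y = Y by rewrite /Y -scaleNr -rmorphN starZ conjC_realc sP.
  have Yb : opbound (2^-1) Y.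
    apply/opboundN; apply: opboundW (opboundZ _ Pp).
    rewrite rnorm_real ger0_norm ?invr_ge0 ?(ltW t0)//.
    by rewrite [t^-1 * p]mulrC ler_pdivrMr// /t; lra.
  have [k kP] : exists k, t * (2 * 2^-1 ^+ k) <= eta.
    by apply: geometric_small.
  have [C [sC CY C2 Cb]] := approx_sqrt k sY Yb.
  exists ((Num.sqrt t)%:C *: C); split.
  - by rewrite starZ conjC_realc sC.
  - apply: commrD; last exact: comm_real_scale.
    apply: commr_sym; apply: comm_scale; apply: CY; rewrite /Y -scaleNr.
    exact: comm_scale.
  have -> : (Num.sqrt t)%:C *: C * ((Num.sqrt t)%:C *: C) - (P + t%:C *: I) =
      t%:C *: (C * C - (1 - Y)).
    rewrite opZl opZr scalerA -rmorphM -expr2 sqr_sqrtr ?(ltW t0)//=.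
    rewrite !scalerBr; congr (_ - _); rewrite /Y scalerN opprK scalerA -rmorphM.
    by rewrite divff ?gt_eqF//= scale1r addrC.
  apply: opboundW (opboundZ _ Cb).
  by rewrite rnorm_real ger0_norm// ltW.
have Elb : lbound E 0 by move=> t [/ltW].
have Einf : has_inf E by split=> //; exists 0.
set t0 := inf E.
have t0_ge0 : 0 <= t0 by apply: lb_le_inf.
have sq0 : approx_square (P + t0%:C *: I).
  move=> eta eta0.
  (* An approximate root for a nearby [t] in [E] serves [t0] as well, with [t - t0] added to the
     error. *)
  have [t [tpos tsq] tlt] := inf_adherent (divr_gt0 eta0 (ltr0Sn _ 1)) Einf.
  have tle : t0 <= t by apply: ge_inf => //; exists 0.
  have [B [sB BP Bb]] := tsq _ (divr_gt0 eta0 (ltr0Sn _ 1)).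
  exists B; split=> //.
    have -> : P + t0%:C *: I = (P + t%:C *: I) - (t - t0)%:C *: I.
      by rewrite rmorphB scalerBl opprB addrA addrAC addrK.
    by apply: commrB => //; exact: comm_real_scale.
  have -> : B * B - (P + t0%:C *: I) = (B * B - (P + t%:C *: I)) + (t - t0)%:C *: I.
    by rewrite rmorphB scalerBl !opprD !addrA subrK.
  apply: opboundW (opboundD Bb (opboundZ _ opbound1)).
  rewrite rnorm_real ger0_norm ?subr_ge0// mulr1.
  by move: tlt; rewrite -/t0; lra.
have [t0_gt0|] := ltP 0 t0; last first.
  move=> t0_le0; have : t0 = 0 by apply/le_anti; rewrite t0_le0.
  by move=> t00; move: sq0; rewrite t00 scale0r addr0.
have [J [PJ JP]] := Pinv _ t0_gt0.
have [|d d0 step] := approx_square_step sq0 _ PJ JP.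
  by rewrite starD sP real_scale_star.
(* [e <= d] permits the step and [e <= t0 / 2] keeps [t0 - e] positive. *)
pose e := Num.min d (t0 / 2).
have e0 : 0 < e by rewrite /e lt_min d0 divr_gt0.
have ed : e <= d by rewrite /e ge_min lexx.
have eE : E (t0 - e).
  split; first by rewrite subr_gt0 /e gt_min orbC; apply/orP; left; lra.
  have := step e (ltW e0) ed.
  by rewrite -addrA -scalerBl -rmorphB.
have : t0 <= t0 - e by apply: ge_inf => //; exists 0.
lra.
Qed.

(** The spectrum lives in the unitization, but an inverse [(Y, l)] found there maps to the genuine
    operator [Y + l.1]. *)
Lemma positive_inv P t : positive P -> 0 < t ->
  exists J, (P + t%:C *: I) * J = 1 /\ J * (P + t%:C *: I) = 1.
Proof.
move=> [_ Pspec] t0.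
have : ~ spectrum P (- t%:C).
  move=> /Pspec; rewrite oppr_ge0 lecR => tle; lra.
move=> /contrapT [[Y l]] [h1 h2].
have e1 : P * Y + - - t%:C *: Y + l *: P = 0 := congr1 fst h1.
have e2 : Y * P + l *: P + - - t%:C *: Y = 0 := congr1 fst h2.
have tl : t%:C *: (l *: I) = I.
  by rewrite scalerA -[t%:C]opprK (congr1 snd h1 : - - t%:C * l = 1) scale1r.
rewrite opprK in e1 e2.
exists (Y + l *: I); split.
  by rewrite mulrDl !mulrDr !opZl !mul1r tl opZr mulr1 addrA [P * Y + _ + _]addrAC e1 add0r.
by rewrite mulrDl !mulrDr !opZr !mulr1 tl opZl mul1r addrA [Y * P + _ + _]addrAC e2 add0r.
Qed.

Lemma addc_conj a : a + Num.conj a = (2 * complex.Re a)%:C.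
Proof.
by case: a => u v; apply/eqP; rewrite eq_complex /= mulr_natl mulr2n subrr !eqxx.
Qed.

Lemma op_eq0 G x : star G (G x) = 0 -> G x = 0.
Proof. by move=> GGx; apply: (@inner_eq0 _ A); rewrite star_adjP GGx inner0r. Qed.

Lemma star_mul_eq0 G : star G * G = 0 -> G = 0.
Proof.
move=> GG; apply: adjop_eq => x; apply: op_eq0.
by rewrite -opME GG.
Qed.

(* [1 + aP] is normal with real part [1 + (Re a) P]. *)
Lemma positive_expansive P a n x : positive P -> 0 <= complex.Re a ->
  rnorm x <= rnorm (((1 + a *: P) ^+ n) x).
Proof.
move=> Ppos a0; have [sP _] := Ppos.
have Psq : approx_square P.
  by apply: approx_square_of_inverses => // t; exact: positive_inv.
have low y : rnorm y <= rnorm ((1 + (complex.Re a)%:C *: P) y).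
  have [s0|s0] := eqVneq (complex.Re a) 0; first by rewrite s0 scale0r addr0.
  have -> : 1 + (complex.Re a)%:C *: P =
      (complex.Re a)%:C *: (P + (complex.Re a)^-1%:C *: I).
    by rewrite scalerDr scalerA -rmorphM divff//= scale1r addrC.
  rewrite adjopZ rnormZ rnorm_real ger0_norm//.
  have := approx_square_lower y Psq _; move=> /(_ (complex.Re a)^-1).
  rewrite invr_ge0 => /(_ a0) /(ler_wpM2l a0).
  by rewrite mulrA divff// mul1r.
have low1 y : rnorm y <= rnorm ((1 + a *: P) y).
  apply: le_trans (low y) _; set G := 1 + a *: P.
  have sG : star G = 1 + Num.conj a *: P by rewrite starD star1 starZ sP.
  have nG : normal G by rewrite -[G]expr1; apply: normal_exp; rewrite /normal sP.
  (* The real part is the mean of [G] and [star G], which increase the norm of [y] equally. *)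
  have e : (1 + (complex.Re a)%:C *: P) y *+ 2 = G y + star G y.
    rewrite mulr2n -!adjopD sG /G addrACA [in RHS]addrACA -!scalerDl addc_conj.
    by rewrite -rmorphD /= -mulr2n mulr_natl.
  have : rnorm ((1 + (complex.Re a)%:C *: P) y *+ 2) <= rnorm (G y) *+ 2.
    by rewrite e [leRHS]mulr2n {2}normal_rnorm// rnormD.
  rewrite -scaler_nat rnormZ -(rmorph_nat (real_complex R)) rnorm_real ger0_norm//.
  lra.
elim: n => [|n IH]; first by rewrite expr0.
by rewrite exprS opME; apply: le_trans IH _.
Qed.

(* [D = [S, P]] anticommutes with [P], so [exp (zP) D = D exp (-zP)] is bounded
   in both half planes, hence constant, hence [P D = 0]. *)
Lemma commute_of_commute_square P S : positive P ->
  S * (P * P) = P * P * S -> S * P = P * S.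
Proof.
move=> Ppos SPP; have [sP _] := Ppos.
have [D DE] : exists D, D = S * P - P * S by exists (S * P - P * S).
have PD : P * D = - (D * P).
  by rewrite DE mulrBr mulrBl opprB -!mulrA SPP !mulrA.
have [d [d0 Dd]] := ex_opbound D; have [p [p0 Pp]] := ex_opbound P.
have PD0 : P * D = 0.
  (* Liouville with right exponent 0, so that only [exp (zP) D x] has to be bounded. *)
  apply: adjop_eq => x; suff : (P * D + D * 0) x = 0 by rewrite mulr0 addr0.
  apply: (@op_liouville _ _ _ _ _ _ _ (expR 1 * (d * rnorm x))) => r r0.
  have [|n [n0 nP]] := @exp_quadratic_small _ (r ^+ 2 * p ^+ 2).
    by rewrite mulr_ge0 ?sqr_ge0.
  exists n; split=> // z zr; set a := z / n%:R.
  have ar : rnorm a ^+ 2 * p ^+ 2 = r ^+ 2 * p ^+ 2 / n%:R ^+ 2.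
    rewrite /a -(rmorph_nat (real_complex R)) -fmorphV rnormM rnorm_real zr.
    by rewrite ger0_norm ?invr_ge0// exprMn exprVn mulrAC.
  rewrite scaler0 addr0 expr1n mulr1.
  have [a0|a0] := leP 0 (complex.Re a).
    (* Move [D] to the left, then bound [(1 - aP)^n x] by inserting the expansive factor
       [(1 + aP)^n]. *)
    have aP := @opbound_conj_exp _ _ _ _ _ a n p0 Pp x; rewrite ar opME in aP.
    rewrite (@intertwineX _ _ _ _ (1 - a *: P)); last first.
      by rewrite mulrDl mulrBr mul1r mulr1 opZl opZr PD scalerN.
    rewrite opME; apply: le_trans (Dd _) _; rewrite mulrCA ler_wpM2l//.
    apply: le_trans (positive_expansive n _ Ppos a0) _.
    by apply: le_trans aP _; rewrite ler_wpM2r ?rnorm_ge0.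
  have a0' : 0 <= complex.Re (- a) by rewrite raddfN oppr_ge0 ltW.
  (* Here [(1 - aP)^n] is the expansive factor, inserted in front of [(1 + aP)^n D x]. *)
  have aP := @opbound_conj_exp _ _ _ _ _ (- a) n p0 Pp (D x).
  rewrite rnormN ar opME scaleNr opprK -scaleNr in aP.
  rewrite opME; apply: le_trans (positive_expansive n _ Ppos a0') _.
  apply: le_trans aP _; apply: ler_pM (Dd x) => //; last exact: rnorm_ge0.
  by apply: exprn_ge0; apply: addr_ge0 => //; apply: divr_ge0;
    [apply: mulr_ge0; exact: sqr_ge0 | exact: sqr_ge0].
have DP0 : D * P = 0 by apply/oppr_inj; rewrite -PD PD0 oppr0.
have DD : star D * D = P * star S * D.
  by rewrite {1}DE starB !opMstar sP mulrBl -[star S * P * D]mulrA PD0 mulr0 subr0.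
have DDP : star D * D * P = 0 by rewrite -mulrA DP0 mulr0.
(* [star D * D = P * star S * D] is killed on the left by [star D * D], as [D * P = 0]. So the
   self-adjoint [star D * D] squares to 0 and vanishes, and then so does [D]. *)
have /star_mul_eq0/star_mul_eq0/eqP : star (star D * D) * (star D * D) = 0.
  by rewrite opMstar starK {2}DD !mulrA DDP !mul0r.
by rewrite DE subr_eq0 => /eqP.
Qed.

End PositiveOperators.

(** * Polar decomposition of a normal operator *)

Section PolarDecomposition.
Context {R : realType} {A : cstarAlgType R[i]} {X : hilbertModType A}.
Implicit Types (x : X) (N P S T V : adjop X).

Lemma mulr_eq_ker S T : Ker S `<=` Ker T -> forall C, S * C = 0 -> T * C = 0.
Proof.
move=> kST C SC; apply: adjop_eq => x; apply: kST.
by rewrite /Ker /= -opME SC.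
Qed.

Lemma Ker_star_mul T : Ker (star T * T) = Ker T.
Proof.
rewrite eqEsubset; split=> x; first exact: op_eq0.
move=> Tx0; change (star T (T x) = 0).
by rewrite (Tx0 : T x = 0) linear0.
Qed.

Lemma partial_isometry_mulr_star V : partial_isometry V ->
  V * (1 - star V * V) = 0.
Proof.
by rewrite /partial_isometry !amulE mulrBr mulr1 mulrA => ->; rewrite subrr.
Qed.

(** Let [E = star V * V] and [F = V * star V]. Equal kernels give [E = E F] and [F = F E]; taking
    adjoints in the first gives [E = F E = F]. *)
Lemma partial_isometry_same_ker V : partial_isometry V ->
  Ker V = Ker (star V) -> star V * V = V * star V.
Proof.
move=> VVV kV; have VVV' : partial_isometry (star V).
  move: VVV; rewrite /partial_isometry !amulE => /(congr1 star).
  by rewrite !opMstar starK mulrA.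
have EF : star V * V = star V * V * (V * star V).
  apply/eqP; rewrite -subr_eq0 -{1}[star V * V]mulr1 -mulrBr -mulrA.
  have := partial_isometry_mulr_star VVV'; rewrite starK => h.
  by rewrite (@mulr_eq_ker (star V) V _ _ h) ?kV// mulr0.
have FE : V * star V = V * star V * (star V * V).
  apply/eqP; rewrite -subr_eq0 -{1}[V * star V]mulr1 -mulrBr -mulrA.
  have h := partial_isometry_mulr_star VVV.
  by rewrite (@mulr_eq_ker V (star V) _ _ h) ?kV// mulr0.
have sE : star (star V * V) = star V * V by rewrite opMstar starK.
have sF : star (V * star V) = V * star V by rewrite opMstar starK.
by rewrite -[LHS]sE EF opMstar sE sF -FE.
Qed.

(** Normality equates the kernels of [T] and [star T], hence those of [V] and [star V]. Also
    [V P^2 (star V) = T (star T) = P^2]; multiplying by [V] on the right shows that [V] commutes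
    with [P^2], hence with [P]. *)
Lemma polar_normal_factor T V P : normal T -> partial_isometry V ->
  T = V * P -> Ker V = Ker T -> Ker (star V) = Ker (star T) ->
  positive P -> P * P = star T * T ->
  [/\ star V * V = V * star V, P * (star V * V) = P & V * P = P * V].
Proof.
move=> nT VVV TV kV kVs Ppos PP; have [sP _] := Ppos.
have kT : Ker T = Ker (star T).
  by rewrite -Ker_star_mul -(Ker_star_mul (star T)) starK -!amulE nT.
have EF : star V * V = V * star V.
  by apply: partial_isometry_same_ker => //; rewrite kV kVs.
have kP : Ker P = Ker V by rewrite kV -(Ker_star_mul T) -PP -(Ker_star_mul P) sP.
have PE : P * (star V * V) = P.
  apply/eqP; rewrite eq_sym -subr_eq0 -{1}[P]mulr1 -mulrBr.
  by rewrite (@mulr_eq_ker V P _ _ (partial_isometry_mulr_star VVV)) ?kP.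
split=> //; apply: commute_of_commute_square => //.
have : T * star T = P * P by rewrite PP -!amulE nT.
rewrite {1}TV TV opMstar sP => /(congr1 ( *%R^~ V)).
by rewrite -!mulrA PE.
Qed.

End PolarDecomposition.

Theorem corollary2p9 (R : realType) (A : cstarAlgType R[i])
    (X : hilbertModType A) (T S : adjop X) :
  normal T -> normal (T ** S) -> has_polar_decomposition T ->
  (normal (S ** T) <-> commutes S (modulus T)).
Proof.
move=> nT nTS [V [VVV TV [kV kVs] _ _]]; rewrite /commutes !amulE in nTS TV *.
have [Psqrt|noP] :=
  pselect (exists Q : adjop X, positive Q /\ Q ** Q = star T ** T); last first.
  (* Without a square root of [T^* T], [modulus T] is the junk value 0. *)
  have P0 : modulus T = 0 by apply: xgetPN => Q QP; apply: noP; exists Q.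
  have T0 : T = 0 by rewrite TV P0 mulr0.
  by rewrite P0 T0 !mulr0 mul0r /normal !amulE mulr0 mul0r.
have [Ppos PP] : positive (modulus T) /\ modulus T ** modulus T = star T ** T.
  exact: (xgetPex 0 Psqrt).
move: (modulus T) TV Ppos PP => P TV Ppos; rewrite !amulE => PP.
have [sP _] := Ppos.
split=> [nST|SP].
  apply: commute_of_commute_square => //; rewrite PP.
  have := fuglede_putnam nTS nST (esym (mulrA T S T)).
  rewrite !opMstar mulrA -[T * star T]nT amulE -mulrA => /(congr1 star).
  by rewrite !opMstar !starK => ->.
have [EF PE VP] := polar_normal_factor nT VVV TV kV kVs Ppos PP.
set N := T * S in nTS.
(* The projection [V * star V] fixes the range of [V], which contains that of [N]. *)
have FN : V * star V * N = N.
  rewrite /N TV !mulrA; congr (_ * _ * _); exact: VVV.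
have NsF : star N * (V * star V) = star N.
  by rewrite -{2}FN !opMstar starK mulrA.
have NN : star N * N = N * star N := nTS.
(* This is where normality of [N] enters: [1 - V * star V] is killed by [N * star N], which is
   [star N * N] and has the kernel of [N]. *)
have NF : N * (V * star V) = N.
  have NNF : star N * N * (1 - V * star V) = 0.
    by rewrite NN -mulrA mulrBr mulr1 NsF subrr mulr0.
  apply/eqP; rewrite eq_sym -subr_eq0 -{1}[N]mulr1 -mulrBr.
  by rewrite (@mulr_eq_ker _ _ _ (star N * N) N _ _ NNF) ?Ker_star_mul.
(* [S V P = S P V = P S V], and [P = star V * V * P] brings out [N = V P S]. *)
have ST : S * T = star V * N * V.
  have EP : star V * V * P = P.
    by rewrite -[RHS]sP -{2}PE !opMstar starK sP.
  by rewrite {1}TV VP mulrA SP -{1}EP /N {1}TV !mulrA.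
clearbody N.
rewrite /normal !amulE ST !opMstar starK.
have -> : star V * (star N * V) * (star V * N * V) = star V * (star N * N) * V.
  by rewrite -{4}FN !mulrA.
by rewrite NN -{1}NF !mulrA.
Qed.
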